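(* Let $H\in(0,1)$, $1<\alpha\le2$, and let $Z^H=\{Z^H(t),t\ge0\}$, $Z^H(t)=W^H(L_t)$, be the $\alpha$-stable local time $H$-fractional Brownian motion with values in $\mathbb{R}$. Let $A_7,A_8$ be positive finite constants such that for all $0\le a<b<\infty$ and all $x>0$, $$\mathbb{P}\Big\{\max_{a\le t\le b}|Z^H(t)-Z^H(a)|>x\Big\}\le A_7\exp\left(-A_8\,\frac{x^{2\alpha/(\alpha+2H)}}{(b-a)^{2H(\alpha-1)/(\alpha+2H)}}\right).$$ Then the following statements hold. (i) Almost surely, $$\limsup_{t\to\infty}\frac{\max_{0\le s\le t}|Z^H(s)|}{t^{H(\alpha-1)/\alpha}(\log\log t)^{(\alpha+2H)/(2\alpha)}}\le A_8^{-(\alpha+2H)/(2\alpha)}.$$ (ii) For every $t>0$, almost surely $$\limsup_{h\downarrow0}\frac{\max_{|s|\le h}|Z^H(t+s)-Z^H(t)|}{h^{H(\alpha-1)/\alpha}(\log\log 1/h)^{(\alpha+2H)/(2\alpha)}}\le A_8^{-(\alpha+2H)/(2\alpha)}.$$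
   Context: $W^H=\{W^H(t),t\in\mathbb{R}\}$ is a real-valued fractional Brownian motion of Hurst index $H$: a centered Gaussian process with continuous sample paths, $W^H(0)=0$ and $\mathbb{E}(W^H(s)W^H(t))=\frac12(|s|^{2H}+|t|^{2H}-|s-t|^{2H})$. $X=\{X_t,t\ge0\}$ is a real-valued strictly stable Lévy process of index $\alpha\in(1,2]$ (with $X_0=0$), independent of $W^H$, with characteristic function $\mathbb{E}[e^{i\xi X_t}]=\exp\big(-t|\xi|^\alpha\frac{1+i\nu\,\mathrm{sgn}(\xi)\tan(\pi\alpha/2)}{\chi}\big)$, where $-1\le\nu\le1$ and $\chi>0$ are constants. The local time $L(x,t)$ of $X$ is the density with respect to Lebesgue measure of the occupation measure $A\mapsto\lambda_1\{s\in[0,t]:X_s\in A\}$, in a version jointly continuous in $(x,t)$; $L_t:=L(0,t)$ is the local time at zero. $Z^H(t)=W^H(L_t)$ for $t\ge0$. Positive finite constants $A_7,A_8$ with the stated tail bound exist and depend only on $H,\alpha,\nu,\chi$. *)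

(* Defs.v *)
From mathcomp Require Import all_boot all_order all_algebra.
From mathcomp Require Import complex.
From mathcomp Require Import all_classical all_reals all_analysis.

Set Implicit Arguments.
Unset Strict Implicit.
Unset Printing Implicit Defensive.

Import Order.TTheory GRing.Theory Num.Theory.
Import numFieldNormedType.Exports.
Local Open Scope classical_set_scope.
Local Open Scope ring_scope.

(* [normal_prob m 0] is not the point mass at [m], whence the case split. *)
Definition gaussian_rv (R : realType) d (T : measurableType d)
    (P : probability T R) (Y : T -> R) : Prop :=
  exists m s : R, forall A : set R, measurable A ->
    P (Y @^-1` A) = (if s == 0 then \d_m A else normal_prob m s A).

Definition gaussian_process (R : realType) d (T : measurableType d)
    (P : probability T R) (W : R -> {RV P >-> R}) : Prop :=
  forall (n : nat) (t c : 'I_n -> R),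
    gaussian_rv P (fun w => \sum_(i < n) c i * W (t i) w).
Arguments gaussian_process {R d T} P W.

Record fractional_brownian_motion (R : realType) d (T : measurableType d)
    (P : probability T R) (H : R) (W : R -> {RV P >-> R}) : Prop := {
  fbm_gaussian : gaussian_process P W ;
  fbm_centered : forall t, ('E_P[W t] = 0)%E ;
  fbm_continuous : forall w, continuous (fun t => W t w) ;
  fbm_0 : forall w, W 0 w = 0 ;
  fbm_covariance : forall s t, 'E_P[fun w => (W s w * W t w)%R]%E =
    (2^-1 * (`|s| `^ (2 * H) + `|t| `^ (2 * H) - `|s - t| `^ (2 * H)))%:E
}.
Arguments fractional_brownian_motion {R d T} P H W.

(* Taking some [A i] to be [setT] gives the product rule for subfamilies. *)
Definition mutually_independent (R : realType) d (T : measurableType d)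
    (P : probability T R) (n : nat) (Y : 'I_n -> T -> R) : Prop :=
  forall A : 'I_n -> set R, (forall i, measurable (A i)) ->
    P [set w | forall i, A i (Y i w)] =
    (\prod_(i < n) P (Y i @^-1` A i))%E.

Definition cadlag (R : realType) (x : R -> R) : Prop :=
  (forall t, 0 <= t -> x s @[s --> t^'+] --> x t) /\
  (forall t, 0 < t -> cvg (x s @[s --> t^'-])).

(* Only the times [t >= 0] of [X] are meaningful. *)
Record levy_process (R : realType) d (T : measurableType d)
    (P : probability T R) (X : R -> {RV P >-> R}) : Prop := {
  levy_0 : {ae P, forall w, X 0 w = 0} ;
  levy_independent_increments : forall (n : nat) (t : nat -> R),
    0 <= t 0%N -> (forall i, (i < n)%N -> t i < t i.+1) ->
    mutually_independent P (fun (i : 'I_n) w => X (t i.+1) w - X (t i) w) ;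
  levy_stationary_increments : forall s t, 0 <= s -> 0 <= t ->
    forall A : set R, measurable A ->
      P ((fun w => X (s + t) w - X s w) @^-1` A) = P (X t @^-1` A) ;
  levy_cadlag : {ae P, forall w, cadlag (fun t => X t w)}
}.
Arguments levy_process {R d T} P X.

Definition expC (R : realType) (z : R[i]) : R[i] :=
  (expR (complex.Re z))%:C%C * (cos (complex.Im z) +i* sin (complex.Im z))%C.

Definition charfun (R : realType) d (T : measurableType d)
    (P : probability T R) (Y : T -> R) (xi : R) : R[i] :=
  ((\int[P]_w cos (xi * Y w))%R +i* (\int[P]_w sin (xi * Y w))%R)%C.

Definition stable_levy_process (R : realType) d (T : measurableType d)
    (P : probability T R) (alpha nu chi : R) (X : R -> {RV P >-> R}) : Prop :=
  levy_process P X /\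
  forall t xi : R, 0 <= t ->
    charfun P (X t) xi =
    expC (- ((t * `|xi| `^ alpha)%:C%C *
      ((1 +i* (nu * Num.sg xi * tan (pi * alpha / 2)))%C / chi%:C%C))).
Arguments stable_levy_process {R d T} P alpha nu chi X.

Definition process_sigma_algebra (R : realType) d (T : measurableType d)
    (D : set R) (Y : R -> T -> R) : set (set T) :=
  <<s \bigcup_(t in D) preimage_set_system setT (Y t) measurable >>.

Definition independent_processes (R : realType) d (T : measurableType d)
    (P : probability T R) (D1 : set R) (Y1 : R -> T -> R)
    (D2 : set R) (Y2 : R -> T -> R) : Prop :=
  forall A B : set T, process_sigma_algebra D1 Y1 A ->
    process_sigma_algebra D2 Y2 B -> P (A `&` B) = (P A * P B)%E.

(* [L x t] is the local time at level [x] up to time [t >= 0]. The version is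
   continuous on every path, which makes the maxima of
   [local_time_fbm] over compact intervals measurable. *)
Record local_time (R : realType) d (T : measurableType d)
    (P : probability T R) (X : R -> {RV P >-> R})
    (L : R -> R -> {RV P >-> R}) : Prop := {
  local_time_density : {ae P, forall w, forall (t : R) (A : set R),
    0 <= t -> measurable A ->
    lebesgue_measure [set s | 0 <= s <= t /\ A (X s w)] =
    (\int[lebesgue_measure]_(x in A) (L x t w)%:E)%E} ;
  local_time_continuous : forall w,
    {within [set p : R * R | 0 <= p.2], continuous (fun p => L p.1 p.2 w)}
}.
Arguments local_time {R d T} P X L.

Definition local_time_fbm (R : realType) d (T : measurableType d)
    (P : probability T R) (W : R -> {RV P >-> R}) (L : R -> R -> {RV P >-> R})
    (t : R) (w : T) : R :=
  W (L 0 t w) w.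

(* This is the maximum when [f] is continuous and [A] compact and nonempty;
   for unbounded [f @` A] the real-valued [sup] is 0. *)
Definition max_on (R : realType) (A : set R) (f : R -> R) : R := sup (f @` A).

(* Main.v *)
Require Import Defs.
From mathcomp Require Import all_boot all_order all_algebra.
From mathcomp Require Import complex.
From mathcomp Require Import all_classical all_reals all_analysis.
From mathcomp Require Import measurable_realfun ring lra.
Import Order.TTheory GRing.Theory Num.Theory.
Import numFieldNormedType.Exports.
Local Open Scope classical_set_scope.
Local Open Scope ring_scope.

(**
Write Z for the process, M(t) for its running maximum of |Z| over [0, t],
p = 2 alpha / (alpha + 2 H) and q = 2 H (alpha - 1) / (alpha + 2 H), so that
the tail bound on [0, t] reads P(M(t) > x) <= A7 exp(- A8 x^p / t^q), and the
normalisation of the theorem is t^(q/p) (log log t)^(1/p), called [lil_gauge].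

Statement (i) is the upper half of a law of the iterated logarithm, and rests
on this tail bound and the monotonicity of M.  Fix u > 0.  At the times
t_n = e^(u (n + m)) the tail of M(t_n) at the level
e^u A8^(-1/p) t_n^(q/p) (log log t_n)^(1/p) is at most
A7 (log t_n)^(-g) = A7 (u (n + m))^(-g) with g = e^(u p) > 1, which is
summable.  By Borel-Cantelli the levels are eventually not exceeded; since M
is nondecreasing and t_(n+1) <= e^u t for t >= t_n, interpolating between
consecutive times costs a factor which tends to 1 with u ([lil_upper_bound]).
The bound applies to the maximum of |Z(s) - Z(0)|, and Z(0) = W(L_0) = 0
almost surely because the local time vanishes at time 0 ([local_time_start]).

Statement (ii) is true for a more drastic reason: at a fixed time t > 0 the
process is almost surely constant near t, so that the quotient vanishes for
small h.  Indeed neither X_t nor the left limit X_(t-) is 0, almost surely.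
Hence X stays away from 0 on a neighbourhood of t ([stable_bounded_away]), its
occupation measure puts no mass near 0 during that time, and the continuous
density L(0, .) does not move ([local_time_locally_constant]); neither does
W(L(0, .)).

That X_t and X_(t-) are nonzero comes from the decay of the characteristic
function: E cos(xi X_s) <= exp(- s |xi|^alpha / chi).  A sum of n cosines of
the multiples of M X_s is of size n when X_s is close to 0, while its second
moment is of order n + n^2 delta if all the expectations of cosines with
frequency at least M are at most delta.  So P(|X_s| < e) is small when e is,
uniformly for s bounded away from 0 ([stable_small_ball]), and along a
sequence of times increasing to t the probability that X tends to 0 is 0.
*)

Set Implicit Arguments.
Unset Strict Implicit.
Unset Printing Implicit Defensive.

(** * Upper limits and running maxima *)

Lemma limf_esup_le_near (R : realType) (T : choiceType) (X : filteredType T)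
  (F : set (set X)) (f : X -> \bar R) (c : \bar R) :
  F [set x | (f x <= c)%E] -> (limf_esup f F <= c)%E.
Proof.
move=> Fc; rewrite limf_esupE.
apply: (@le_trans _ _ (ereal_sup (f @` [set x | (f x <= c)%E]))).
  by apply: ereal_inf_lbound; exists [set x | (f x <= c)%E].
by apply: ge_ereal_sup => _ [x /= fxc <-].
Qed.

Lemma eq_max_on (R : realType) (A : set R) (f g : R -> R) :
  (forall s, A s -> f s = g s) -> max_on A f = max_on A g.
Proof. by move=> fg; congr (sup _); exact: eq_imagel. Qed.

Lemma max_on_cst (R : realType) (A : set R) (f : R -> R) (c : R) :
  A !=set0 -> (forall s, A s -> f s = c) -> max_on A f = c.
Proof.
move=> [a Aa] fc; rewrite /max_on (_ : f @` A = [set c]) ?sup1//.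
apply/seteqP; split => [_ [s As <-]|_ ->]; first exact: fc.
by exists a => //; exact: fc.
Qed.

Lemma max_on_ub (R : realType) (f : R -> R) (A : set R) :
  compact A -> {within A, continuous f} -> forall s, A s -> f s <= max_on A f.
Proof.
move=> cA cf s As.
have [|c cAx fc] := compact_EVT_max _ cA cf; first by exists s.
apply: ub_le_sup; last by exists s.
by exists (f c) => _ [u Au <-]; apply: fc; rewrite inE.
Qed.

Lemma max_on_subset (R : realType) (A B : set R) (f : R -> R) :
  A !=set0 -> A `<=` B -> compact B -> {within B, continuous f} ->
  max_on A f <= max_on B f.
Proof.
move=> [a Aa] AB cB cf; apply: ge_sup; first by exists (f a), a.
by move=> _ [s As <-]; apply: max_on_ub => //; exact: AB.
Qed.

(** Strictly exceeding a level is an existential statement about the times of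
[A], which a countable dense set of times can then decide. *)
Lemma lt_max_onP (R : realType) (f : R -> R) (A : set R) (x : R) :
  A !=set0 -> compact A -> {within A, continuous f} ->
  x < max_on A f <-> exists2 s, A s & x < f s.
Proof.
move=> A0 cA cf; split=> [|[s As xs]].
  case/sup_gt; first by case: A0 => s As; exists (f s), s.
  by move=> _ [s As <-] xs; exists s.
exact: lt_le_trans xs (max_on_ub cA cf As).
Qed.

Lemma floor_grid_cvg (R : realType) (y : R) :
  (Num.floor (n.+1%:R * y))%:~R / n.+1%:R @[n --> \oo] --> y.
Proof.
apply/cvgrPdist_lt => e e0; near=> n.
have n0 : 0 < n.+1%:R :> R by [].
have /andP[h1 h2] := floor_itv (n.+1%:R * y).
have en : n.+1%:R^-1 < e by near: n; exact: near_infty_natSinv_lt (PosNum e0).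
have -> : y - (Num.floor (n.+1%:R * y))%:~R / n.+1%:R =
  (n.+1%:R * y - (Num.floor (n.+1%:R * y))%:~R) / n.+1%:R.
  by rewrite mulrBl [n.+1%:R * y]mulrC mulfK ?gt_eqF.
rewrite ger0_norm; last by rewrite divr_ge0// subr_ge0.
apply: le_lt_trans en; rewrite ler_pdivrMr// mulVf ?gt_eqF//.
by rewrite intrD in h2; lra.
Unshelve. all: by end_near. Qed.

(** Sampling at the time [tau] rounded down to the grid of step 1/(n+1) only
involves countably many of the variables [V t]; continuity of the paths lets
the step go to 0. *)
Lemma measurable_random_time (R : realType) d (T : measurableType d)
    (V : R -> T -> R) (tau : T -> R) :
  (forall t, measurable_fun setT (V t)) ->
  (forall w, continuous (fun t => V t w)) ->
  measurable_fun setT tau ->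
  measurable_fun setT (fun w => V (tau w) w).
Proof.
move=> mV cV mtau.
pose k n w := Num.floor (n.+1%:R * tau w).
apply: (measurable_fun_cvg (h := fun n w => V ((k n w)%:~R / n.+1%:R) w)) => [n|w _].
  move=> _ Y mY; rewrite setTI.
  have -> : (fun w => V ((k n w)%:~R / n.+1%:R) w) @^-1` Y =
    \bigcup_(j : int)
      (((fun w => n.+1%:R * tau w) @^-1` `[j%:~R, (j + 1)%:~R[%classic) `&`
        (V (j%:~R / n.+1%:R) @^-1` Y)).
    apply/seteqP; split => [w Yw|w [j _ [/= jw Yw]]].
      exists (k n w) => //; split => //=.
      by rewrite in_itv/=; exact: floor_itv.
    rewrite /= (_ : k n w = j) //; apply/eqP; rewrite floor_eq.
    by move: jw; rewrite in_itv.
  apply: countable_bigcupT_measurable; first exact: countableP.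
  move=> j; apply: measurableI; rewrite -[X in measurable X]setTI.
    have mt : measurable_fun setT (fun w => n.+1%:R * tau w).
      exact: measurable_funM.
    exact: mt.
  exact: mV.
by have := cvg_comp _ _ (@floor_grid_cvg R (tau w)) (@cV w (tau w)).
Qed.

Lemma continuous_clamp (R : realType) (a b : R) :
  continuous (fun s : R => Num.max a (Num.min b s)).
Proof.
move=> s; apply: continuous_max; first exact: cst_continuous.
by apply: continuous_min; [exact: cst_continuous|exact: cvg_id].
Qed.

(** For continuous paths the running maximum exceeds [x] iff the path does so
at a rational time; rational times are first pushed into [a, b], since [a] and
[b] may be the only candidates and may be irrational. *)
Lemma measurable_lt_max_on (R : realType) d (T : measurableType d)
    (Y : R -> T -> R) (a b x : R) : a <= b ->
  (forall t, measurable_fun setT (Y t)) ->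
  (forall w, continuous (fun t => Y t w)) ->
  measurable [set w | x < max_on [set t | a <= t <= b] (Y ^~ w)].
Proof.
move=> ab mY cY.
pose cl s := Num.max a (Num.min b s).
have clP s : a <= cl s <= b.
  by rewrite /cl le_max lexx/= ge_max ab/= ge_min lexx.
have cl_id s : a <= s <= b -> cl s = s.
  by case/andP=> sa sb; rewrite /cl min_r// max_r.
have -> : [set w | x < max_on [set t | a <= t <= b] (Y ^~ w)] =
    \bigcup_(q : rat) [set w | x < Y (cl (ratr q)) w].
  have [cab nab] : compact [set t | a <= t <= b] /\ [set t | a <= t <= b] !=set0.
    split; last by exists a; rewrite /= lexx.
    have -> : [set t | a <= t <= b] = `[a, b]%classic.
      by apply/seteqP; split=> t; rewrite /= in_itv.
    exact: segment_compact.
  apply/seteqP; split => [w /= xw|w [q _ /= xw]].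
    have /lt_max_onP[//|//||s sab xs] := xw; first exact/continuous_subspaceT/cY.
    have oU : open [set s | x < Y (cl s) w].
      have cg : continuous (fun s => Y (cl s) w).
        move=> s'; apply: (continuous_comp (g := Y ^~ w)); last exact: cY.
        exact: continuous_clamp.
      apply: (open_comp (f := fun s => Y (cl s) w) (D := [set y | x < y])).
        by move=> ? _; exact: cg.
      exact: open_gt.
    have [|r [xr [q _ qr]]] := dense_rat _ oU.
      by exists s; rewrite /= cl_id.
    by exists q => //=; rewrite qr.
  apply/lt_max_onP => //; first exact/continuous_subspaceT/cY.
  by exists (cl (ratr q)) => //=.
apply: countable_bigcupT_measurable; first exact: countableP.
move=> q; rewrite -[X in measurable X]setTI.
rewrite (_ : mkset _ = Y (cl (ratr q)) @^-1` `]x, +oo[%classic).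
  exact: mY.
by apply/seteqP; split => w /=; rewrite in_itv/= andbT.
Qed.

(** * Convergence of p-series and the Borel-Cantelli lemma *)

(** The terms telescope: s (x+1)^(-(1+s)) <= x^(-s) - (x+1)^(-s), a form of
the mean value inequality obtained here from 1 + z <= e^z and
log (1 - z) <= - z. *)
Lemma sum_powRN_bounded (R : realType) (s : R) (n : nat) : 0 < s ->
  \sum_(0 <= k < n.+1) k.+1%:R `^ (- (1 + s)) <=
    1 + s^-1 * (1 - n.+1%:R `^ (- s)).
Proof.
move=> s0; elim: n => [|n IHn].
  by rewrite big_nat1 !powR1 subrr mulr0 addr0.
rewrite big_nat_recr//=; apply: (le_trans (lerD IHn (lexx _))).
set x := n.+1%:R : R; have x0 : 0 < x by [].
have -> : n.+2%:R = x + 1 :> R by rewrite /x -natr1.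
set y := x + 1; have y0 : 0 < y by rewrite addr_gt0.
suff : s * y `^ (- (1 + s)) <= x `^ (- s) - y `^ (- s).
  move=> h; rewrite -addrA lerD2l -(ler_pM2l s0) mulrDr !mulrA divff ?gt_eqF//.
  by lra.
have -> : y `^ (- (1 + s)) = y `^ (- s) * y^-1.
  by rewrite opprD addrC powRD ?(gt_eqF y0) ?implybT// powR_inv1// ltW.
have -> : x `^ (- s) = y `^ (- s) * (y / x) `^ s.
  rewrite powRM ?invr_ge0 ?ltW//.
  have -> : x^-1 `^ s = x `^ (- s).
    by rewrite /powR invr_eq0 gt_eqF// lnV ?posrE// mulrN mulNr.
  by rewrite mulrA -powRD ?addNr ?powRr0 ?mul1r// (gt_eqF y0) implybT.
rewrite mulrCA -{3}[y `^ (- s)]mulr1 -mulrBr ler_pM2l ?powR_gt0//.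
have yx0 : 0 < y / x by rewrite divr_gt0.
rewrite lerBrDl /powR gt_eqF//; apply: le_trans (expR_ge1Dx _).
rewrite lerD2l ler_pM2l//.
have -> : y / x = (1 + - y^-1)^-1.
  by rewrite /y; field; rewrite ?gt_eqF //= /y -?addrA; lra.
have h1 : 1 + - y^-1 = x / y by rewrite /y; field; rewrite gt_eqF.
rewrite lnV ?posrE; last by rewrite h1 divr_gt0.
by rewrite lerNr; apply: le_ln1Dx; rewrite ltrN2 invf_lt1// /y ltrDr.
Qed.

Lemma borel_cantelli_eventually (R : realType) d (T : measurableType d)
    (P : probability T R) (E : (set T)^nat) (C g : R) :
  0 <= C -> 1 < g -> (forall n, measurable (E n)) ->
  (forall n, (P (E n) <= (C * n.+1%:R `^ (- g))%:E)%E) ->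
  {ae P, forall w, exists n0, forall n, (n0 <= n)%N -> ~ E n w}.
Proof.
move=> C0 g1 mE PE; set s := g - 1.
have s0 : 0 < s by rewrite subr_gt0.
have sum_lty : (\sum_(n <oo) P (E n) < +oo)%E.
  apply: (@le_lt_trans _ _ (C * (1 + s^-1))%:E); last exact: ltry.
  apply: lime_le; first exact: is_cvg_nneseries.
  apply: nearW => n.
  apply: (@le_trans _ _ (\sum_(0 <= k < n.+1) P (E k))%E).
    by rewrite big_nat_recr//= leeDl.
  apply: (@le_trans _ _ (\sum_(0 <= k < n.+1) (C * k.+1%:R `^ (- g))%:E)%E).
    by apply: lee_sum.
  rewrite sumEFin lee_fin -mulr_sumr ler_wpM2l//.
  have -> : g = 1 + s by rewrite /s addrC subrK.
  apply: le_trans (sum_powRN_bounded _ s0) _.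
  by rewrite lerD2l ler_piMr ?invr_ge0 ?ltW// gerBl powR_ge0.
exists (lim_sup_set E); split.
- by apply: bigcap_measurable => // n _; apply: bigcup_measurable.
- exact: lim_sup_set_cvg0.
- move=> w /= nE n _; apply: contrapT => h; apply: nE; exists n => k nk Ek.
  by apply: h; exists k.
Qed.

(** * An upper law of the iterated logarithm *)

Lemma near_lnln_ge (R : realType) (K : R) :
  \forall t \near +oo, K <= ln (ln t).
Proof.
exists (expR (expR K)); split; first exact: num_real.
move=> t tK; have t0 : 0 < t by apply: lt_trans tK; exact: expR_gt0.
have lt : expR K < ln t by rewrite -ltr_expR lnK.
rewrite -ler_expR lnK; first exact: ltW.
by rewrite posrE; apply: lt_trans lt; exact: expR_gt0.
Qed.

(** Once log t >= u, log (e^u t) = u + log t <= 2 log t, so that dilating the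
time adds at most log 2 to log log t; this is at most (e^u - 1) log log t when
t is large. *)
Lemma near_lnln_dilate (R : realType) (u : R) : 0 < u ->
  \forall t \near +oo, ln (ln (expR u * t)) <= expR u * ln (ln t).
Proof.
move=> u0.
have e1 : 0 < expR u - 1 by rewrite subr_gt0 expR_gt1.
near=> t.
have t1 : 1 < t by near: t; apply: nbhs_pinfty_gt; exact: num_real.
have t0 : 0 < t by apply: lt_trans t1.
have tu : expR u <= t by near: t; apply: nbhs_pinfty_ge; exact: num_real.
have ut : u <= ln t by rewrite -ler_expR lnK.
have lt0 : 0 < ln t by apply: lt_le_trans ut.
have K : ln 2 / (expR u - 1) <= ln (ln t) by near: t; exact: near_lnln_ge.
rewrite lnM ?posrE ?expR_gt0// expRK.
apply: (@le_trans _ _ (ln (2 * ln t))).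
  by rewrite ler_ln ?posrE; lra.
rewrite lnM ?posrE//.
by move: K; rewrite ler_pdivrMr//; lra.
Unshelve. all: by end_near. Qed.

Definition lil_gauge (R : realType) (kappa beta t : R) : R :=
  t `^ kappa * ln (ln t) `^ beta.

Lemma lil_gauge_gt0 (R : realType) (kappa beta t : R) :
  0 < t -> 0 < ln (ln t) -> 0 < lil_gauge kappa beta t.
Proof. by move=> t0 llt0; rewrite mulr_gt0// powR_gt0. Qed.

Lemma lil_gauge_le (R : realType) (kappa beta s t : R) :
  0 <= kappa -> 0 <= beta -> 0 < s -> 0 < ln (ln s) -> s <= t ->
  lil_gauge kappa beta s <= lil_gauge kappa beta t.
Proof.
move=> k0 b0 s0 lls0 st.
have t0 : 0 < t by exact: lt_le_trans st.
have ls0 : 0 < ln s by rewrite ltNge; apply/negP => /ln0 h; rewrite h ltxx in lls0.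
have lst : ln s <= ln t by rewrite ler_ln.
have lt0 : 0 < ln t by exact: lt_le_trans lst.
have llst : ln (ln s) <= ln (ln t) by rewrite ler_ln.
apply: ler_pM; rewrite ?powR_ge0//; apply: ge0_ler_powR; rewrite // nnegrE ltW//.
exact: lt_le_trans llst.
Qed.

Lemma powR_expR (R : realType) (u r : R) : expR u `^ r = expR (u * r).
Proof. by rewrite /powR gt_eqF ?expR_gt0// expRK mulrC. Qed.

(** The price of replacing t by e^u t in the normalisation; it tends to 1 as u
tends to 0. *)
Lemma lil_gauge_dilate (R : realType) (kappa beta : R) (u : R) :
  0 <= beta -> 0 < u ->
  \forall t \near +oo, lil_gauge kappa beta (expR u * t) <=
    expR (u * (kappa + beta)) * lil_gauge kappa beta t.
Proof.
move=> b0 u0; near=> t.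
have t1 : 1 < t by near: t; apply: nbhs_pinfty_gt; exact: num_real.
have t0 : 0 < t by apply: lt_trans t1.
have ll0 : 1 <= ln (ln t) by near: t; exact: near_lnln_ge.
have dil : ln (ln (expR u * t)) <= expR u * ln (ln t).
  by near: t; exact: near_lnln_dilate.
have lt0 : 0 < ln t by exact: ln_gt0.
have lll : ln (ln t) <= ln (ln (expR u * t)).
  by rewrite lnM ?posrE ?expR_gt0// expRK ler_ln ?posrE; lra.
have lle : ln (ln (expR u * t)) `^ beta <= expR (u * beta) * ln (ln t) `^ beta.
  rewrite -powR_expR -powRM ?expR_ge0//; last by lra.
  have e0 := expR_gt0 u.
  by apply: ge0_ler_powR; rewrite // nnegrE; nra.
rewrite /lil_gauge powRM ?expR_ge0 ?(ltW t0)// powR_expR mulrDr expRD.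
rewrite -!mulrA; apply: ler_pM; rewrite ?mulr_ge0 ?expR_ge0 ?powR_ge0//.
by rewrite mulrCA; apply: ler_pM; rewrite ?powR_ge0.
Unshelve. all: by end_near. Qed.

(** [M] is any nondecreasing process with the stretched exponential tails of
the running maximum.  The constant A^(-1/p) is the level at which the tail
becomes a power of log t with exponent exactly -1. *)
Section iterated_logarithm.
Context (R : realType) d (T : measurableType d) (P : probability T R).
Variables (M : R -> T -> R) (C A p q : R).
Hypotheses (C0 : 0 <= C) (A0 : 0 < A) (p0 : 0 < p) (q0 : 0 <= q).
Hypothesis mM : forall t x, 0 < t -> 0 < x -> measurable [set w | x < M t w].
Hypothesis ndM : forall w s t, 0 < s -> s <= t -> M s w <= M t w.
Hypothesis tailM : forall t x, 0 < t -> 0 < x ->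
  (P [set w | (x < M t w)%R] <= (C * expR (- (A * (x `^ p / t `^ q))))%:E)%E.

Local Notation phi := (lil_gauge (q / p) p^-1).

(** The powers of t cancel, and the exponent of log t is less than -1 because
of the extra factor e^u in front of the critical level. *)
Lemma tail_at_lil_gauge (u t : R) : 0 < u -> 0 < t -> 0 < ln (ln t) ->
  (P [set w | (expR u * A `^ (- p^-1) * phi t < M t w)%R] <=
    (C * ln t `^ (- expR (u * p)))%:E)%E.
Proof.
move=> u0 t0 llt0.
have x0 : 0 < expR u * A `^ (- p^-1) * phi t.
  by rewrite !mulr_gt0 ?expR_gt0 ?powR_gt0// lil_gauge_gt0.
apply: (le_trans (tailM t0 x0)); rewrite lee_fin ler_wpM2l// le_eqVlt.
apply/orP; left; apply/eqP.
have lt0 : ln t != 0 by apply/negP => /eqP h; move: llt0; rewrite h ln0 // ltxx.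
rewrite [in RHS]/powR (negbTE lt0); congr expR.
rewrite /lil_gauge !powRM ?mulr_ge0 ?expR_ge0 ?powR_ge0//.
rewrite -!powRrM mulNr mulVf ?gt_eqF// mulfVK ?gt_eqF// powRN !powRr1 ?ltW//.
rewrite powR_expR.
by field; rewrite !gt_eqF ?powR_gt0.
Qed.

(** Borel-Cantelli along a geometric sequence of times; [M] is monotone and a
time t lies below the next term of the sequence, which is at most e^u t. *)
Lemma ae_eventually_le (u : R) : 0 < u ->
  {ae P, forall w, \forall t \near +oo,
    M t w <= expR u * A `^ (- p^-1) * phi (expR u * t)}.
Proof.
move=> u0.
pose m := (Num.truncn u^-1).+1.
have mu : 1 < m%:R * u.
  have /truncn_itv/andP[_] : 0 <= u^-1 by rewrite invr_ge0 ltW.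
  by rewrite -/m -ltr_pdivrMr// div1r.
(* The shift by [m] makes log log positive from the first term on. *)
pose tt n := expR ((n + m)%:R * u).
have ltt n : 1 < ln (tt n).
  rewrite expRK; apply: (lt_le_trans mu).
  by rewrite ler_pM2r// ler_nat leq_addl.
have lltt n : 0 < ln (ln (tt n)) by exact: ln_gt0.
pose E n := [set w | expR u * A `^ (- p^-1) * phi (tt n) < M (tt n) w].
have mE n : measurable (E n).
  by apply: mM; rewrite ?mulr_gt0 ?expR_gt0 ?powR_gt0 ?lil_gauge_gt0 ?expR_gt0.
have PE n : (P (E n) <=
    (C * u `^ (- expR (u * p)) * n.+1%:R `^ (- expR (u * p)))%:E)%E.
  apply: (le_trans (tail_at_lil_gauge u0 (expR_gt0 _) (lltt n))).
  rewrite lee_fin -mulrA ler_wpM2l//.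
  rewrite -powRM ?(ltW u0)// !powRN lef_pV2 ?posrE ?powR_gt0 ?mulr_gt0//;
    last exact: lt_trans (ltt n).
  apply: ge0_ler_powR; rewrite ?nnegrE ?mulr_ge0 ?expR_ge0 ?(ltW u0)//.
    exact: ltW (lt_trans ltr01 (ltt n)).
  by rewrite expRK mulrC ler_pM2r// ler_nat /m addnS ltnS leq_addr.
have g1 : 1 < expR (u * p) by rewrite expR_gt1 mulr_gt0.
have CC0 : 0 <= C * u `^ (- expR (u * p)) by rewrite mulr_ge0 ?powR_ge0.
apply: filterS (borel_cantelli_eventually CC0 g1 mE PE) => w [n0 Hn0].
near=> t.
have t1 : 1 < t by near: t; apply: nbhs_pinfty_gt; exact: num_real.
have t0 : 0 < t by apply: lt_trans t1.
have tn0 : tt n0 <= t by near: t; apply: nbhs_pinfty_ge; exact: num_real.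
have lt0 : 0 < ln t by exact: ln_gt0.
have [N /andP[N1 N2]] : exists N : nat, N%:R <= ln t / u < N.+1%:R.
  by exists (Num.truncn (ln t / u)); rewrite truncn_itv// divr_ge0// ltW.
have nN : (n0 + m <= N)%N.
  rewrite -ltnS -(ltr_nat R); apply: le_lt_trans N2.
  by rewrite ler_pdivlMr// -ler_expR lnK.
have [n nmN] : exists n, (n + m = N)%N.
  by exists (N - m)%N; rewrite subnK// (leq_trans _ nN)// leq_addl.
have tle : t <= tt n.+1.
  rewrite /tt addSn nmN -ler_ln ?posrE ?expR_gt0// expRK.
  by rewrite -ler_pdivrMr// ltW.
have let' : tt n.+1 <= expR u * t.
  rewrite /tt addSn nmN -natr1 mulrDl mul1r addrC expRD ler_pM2l ?expR_gt0//.
  by rewrite -[leRHS]lnK ?posrE// ler_expR -ler_pdivlMr.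
apply: (le_trans (ndM w t0 tle)).
have := Hn0 n.+1; rewrite /E /= => /(_ _)/negP; rewrite -leNgt => h.
apply: le_trans (h _) _.
  by apply: leqW; rewrite -(leq_add2r m) nmN.
rewrite ler_pM2l; last by rewrite mulr_gt0 ?expR_gt0 ?powR_gt0.
by apply: lil_gauge_le; rewrite ?divr_ge0 ?invr_ge0 ?expR_gt0 ?(ltW p0).
Unshelve. all: by end_near. Qed.

Lemma lil_upper_bound_approx (u : R) : 0 < u ->
  {ae P, forall w,
    (limf_esup (fun t => (M t w / phi t)%:E) (pinfty_nbhs R) <=
     (A `^ (- p^-1) * expR (u * (1 + q / p + p^-1)))%:E)%E}.
Proof.
move=> u0; apply: filterS (ae_eventually_le u0) => w Mw.
have p0' : 0 <= p^-1 by rewrite invr_ge0 ltW.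
have dil := lil_gauge_dilate (q / p) p0' u0.
apply: limf_esup_le_near.
move: Mw dil (near_lnln_ge (1 : R)); apply: filterS3 => t hM hphi llt /=.
have lt0 : 0 < ln t by rewrite ltNge; apply/negP => /ln0 h; rewrite h ler10 in llt.
have t0 : 0 < t by rewrite ltNge; apply/negP => /ln0 h; rewrite h ltxx in lt0.
have phi0 : 0 < phi t by rewrite lil_gauge_gt0//; exact: lt_le_trans llt.
rewrite lee_fin (ler_pdivrMr _ _ phi0); apply: (le_trans hM).
have -> : u * (1 + q / p + p^-1) = u + u * (q / p + p^-1) by ring.
rewrite expRD (mulrC (expR u)) -!mulrA.
rewrite ler_pM2l; last by rewrite powR_gt0.
by rewrite ler_pM2l ?expR_gt0.
Qed.

Lemma lil_upper_bound :
  {ae P, forall w,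
    (limf_esup (fun t => (M t w / phi t)%:E) (pinfty_nbhs R) <=
     (A `^ (- p^-1))%:E)%E}.
Proof.
(* Countably many dilations e^u keep the exceptional set null. *)
have h n := lil_upper_bound_approx (u := n.+1%:R^-1) (ltac:(by rewrite invr_gt0)).
apply: filterS (ae_foralln h) => w hw.
set B := A `^ (- p^-1); set k := (1 + q / p + p^-1).
apply: (@cvge_to_ge _ \oo _ _
  (fun n : nat => (B * expR (n.+1%:R^-1 * k))%:E)); last first.
  by apply: nearW => n; exact: hw.
apply: cvg_EFin; first exact: nearW.
rewrite -[X in _ --> X]mulr1; apply: cvgM; first exact: cvg_cst.
rewrite [X in _ --> X](_ : 1 = expR (0 * k)); last by rewrite mul0r expR0.
have hk : n.+1%:R^-1 * k @[n --> \oo] --> 0 * k.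
  by apply: cvgM; [exact: cvg_harmonic|exact: cvg_cst].
exact: (cvg_comp _ _ hk (@continuous_expR R (0 * k))).
Qed.

End iterated_logarithm.

(** * Continuous occupation densities *)

(** By Lebesgue differentiation a continuous function is the limit of its
averages over shrinking balls. *)
Lemma eq_of_eq_ball_integrals (R : realType) (f g : R -> R) (a e : R) :
  continuous f -> continuous g -> 0 < e ->
  (forall r, (0 < r)%R -> (r < e)%R ->
    \int[lebesgue_measure]_(x in ball a r) (f x)%:E =
    \int[lebesgue_measure]_(x in ball a r) (g x)%:E)%E ->
  f a = g a.
Proof.
move=> cf cg e0 fg.
have avg (h : R -> R) : continuous h ->
    (r *+ 2)^-1 * \int[lebesgue_measure]_(z in ball a r) h z
      @[r --> 0^'+] --> h a.
  move=> ch.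
  have hI : lebesgue_measure.-integrable `[a - 1, a + 1] (EFin \o h).
    apply: continuous_compact_integrable; first exact: segment_compact.
    exact: continuous_subspaceT.
  apply: (@lebesgue_differentiation_continuous R h (ball a 1)).
  - exact: ball_open.
  - apply: (integrableS _ _ _ hI) => //.
    + exact: measurable_ball.
    + by move=> x; rewrite ball_itv/= !in_itv/= => /andP[/ltW -> /ltW ->].
  - exact: ch.
  - exact: ballxx.
have := avg _ cf; have := avg _ cg => ga fa.
suff ga' : (r *+ 2)^-1 * \int[lebesgue_measure]_(z in ball a r) f z
    @[r --> 0^'+] --> g a.
  exact: (cvg_unique _ fa ga').
apply: cvg_trans ga; apply: near_eq_cvg; near=> r.
by congr (_ * fine _); rewrite fg.
Unshelve. all: by end_near. Qed.

Definition occupation_density (R : realType) (x : R -> R) (l : R -> R -> R) :=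
  forall (t : R) (A : set R), 0 <= t -> measurable A ->
    lebesgue_measure [set s | 0 <= s <= t /\ A (x s)] =
    (\int[lebesgue_measure]_(y in A) (l y t)%:E)%E.

Lemma continuous_comp_within (S U V : topologicalType) (D : set U)
    (f : U -> V) (g : S -> U) :
  {within D, continuous f} -> continuous g -> (forall s, D (g s)) ->
  continuous (f \o g).
Proof.
move=> /subspace_continuousP cf cg Dg s.
have gs : g u @[u --> s] --> within D (nbhs (g s)).
  move=> A /cg gA; apply: (@filterS _ (nbhs s)) gA => u /= h; exact: h (Dg u).
exact: cvg_comp gs (cf _ (Dg s)).
Qed.

(** Pathwise theory of the local time: [x] is one path, and [l y t] a jointly
continuous density of its occupation measure. *)
Section occupation_density.
Context (R : realType) (x : R -> R) (l : R -> R -> R).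
Hypothesis lx : occupation_density x l.
Hypothesis cl :
  {within [set p : R * R | 0 <= p.2], continuous (fun p => l p.1 p.2)}.

Let cl_slice (t : R) : 0 <= t -> continuous (l ^~ t).
Proof.
move=> t0; apply: (continuous_comp_within (g := fun y => (y, t)) cl) => // y.
by apply: (@cvg_pair _ _ _ (nbhs y) (nbhs y) (nbhs t));
  [exact: cvg_id|exact: cvg_cst].
Qed.

(** At time 0 the occupation measure is carried by a single instant, so it is
null and its continuous density vanishes everywhere. *)
Lemma local_time_start (y : R) : l y 0 = 0.
Proof.
apply: (@eq_of_eq_ball_integrals _ (l ^~ 0) (fun=> 0) y 1) => //.
- exact: cl_slice.
- exact: cst_continuous.
move=> r _ _; rewrite [RHS]integral0_eq// -lx//; last exact: measurable_ball.
have [x0|x0] := pselect (ball y r (x 0)).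
  rewrite (_ : mkset _ = [set 0]) ?lebesgue_measure_set1//.
  apply/seteqP; split => [s [/andP[s0 s1] _] /=|_ ->]; last by rewrite /= lexx.
  by apply/eqP; rewrite eq_le s0 s1.
rewrite (_ : mkset _ = set0) ?measure0//.
apply/seteqP; split => // s [/andP[s0 s1] xs] /=; apply: x0.
by rewrite (_ : 0 = s)//; apply/eqP; rewrite eq_le s0 s1.
Qed.

(** While the path avoids the ball of radius [e] around [y], its occupation
measure of smaller balls does not change, hence neither does the continuous
density at [y]. *)
Lemma local_time_locally_constant (y e a b s t : R) : 0 < e ->
  (forall u, a < u < b -> e <= `|x u - y|) ->
  a < s < b -> a < t < b -> 0 <= s -> 0 <= t ->
  l y s = l y t.
Proof.
move=> e0 xe sab tab s0 t0.
apply: (@eq_of_eq_ball_integrals _ (l ^~ s) (l ^~ t) y e) => //.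
- exact: cl_slice.
- exact: cl_slice.
move=> r r0 re; rewrite -!lx//; try exact: measurable_ball.
congr (lebesgue_measure _).
have off u : a < u < b -> ~ ball y r (x u).
  by move=> /xe; rewrite /ball /= distrC => ? ?; lra.
apply/seteqP; split=> u [/andP[u0 us] bu]; split => //; rewrite u0/= leNgt;
  apply/negP => h; apply: (off u) => //; lra.
Qed.
End occupation_density.

(** * Small ball probabilities from the decay of the characteristic function *)

Lemma bounded_integrable (R : realType) d (T : measurableType d)
    (P : probability T R) (f : T -> R) (K : R) :
  measurable_fun setT f -> (forall w, `|f w| <= K) ->
  P.-integrable setT (EFin \o f).
Proof.
move=> mf fK; apply: measurable_bounded_integrable => //.
  exact: le_lt_trans (probability_le1 P measurableT) (ltry 1).
exists K; split; first exact: num_real.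
by move=> x Kx w _ /=; apply: le_trans (fK w) (ltW Kx).
Qed.

Lemma measurable_norm_lt (R : realType) d (T : measurableType d)
    (f : T -> R) (e : R) :
  measurable_fun setT f -> measurable [set w | `|f w| < e].
Proof.
move=> mf; have mnf : measurable_fun setT (fun w => `|f w|).
  exact: measurableT_comp.
rewrite (_ : mkset _ = (fun w => `|f w|) @^-1` `]-oo, e[%classic).
  by rewrite -[X in measurable X]setTI; exact: mnf.
by apply/seteqP; split => w /=; rewrite in_itv.
Qed.

(** A quantitative form of the absence of an atom at 0.  [S n] is a sum of [n]
cosines whose pairwise products have expectation at most [delta], so that its
second moment is at most n + n^2 delta; but [S n] is of order n where [Y] is
close to 0. *)
Section small_ball.
Context (R : realType) d (T : measurableType d) (P : probability T R).
Variables (Y : {RV P >-> R}) (M delta : R).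
Hypotheses (M0 : 0 < M) (delta0 : 0 <= delta).
Hypothesis cosY : forall xi, M <= xi -> \int[P]_w cos (xi * Y w) <= delta.

Let c (j : nat) (w : T) : R := cos (j.+1%:R * M * Y w).
Let S (n : nat) (w : T) : R := \sum_(j < n) c j w.

Let mcos (a : R) : measurable_fun setT (fun w => cos (a * Y w)).
Proof.
apply: (measurableT_comp (f := cos)).
  by apply: continuous_measurable_fun => x; exact: continuous_cos.
exact: measurable_funM.
Qed.

Let cos_le1 (a : R) : `|cos a| <= 1.
Proof. by rewrite ler_norml cos_geN1 cos_le1. Qed.

Let icos (a : R) : P.-integrable setT (EFin \o (fun w => cos (a * Y w))).
Proof. by apply: (bounded_integrable P (K := 1)) => // w; exact: cos_le1. Qed.

Let mS n : measurable_fun setT (S n).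
Proof. by apply: measurable_sum => j; exact: mcos. Qed.

Let S_le n w : `|S n w| <= n%:R.
Proof.
apply: (le_trans (ler_norm_sum _ _ _)).
apply: (@le_trans _ _ (\sum_(j < n) 1)); last by rewrite sumr_const card_ord.
by apply: ler_sum => j _; exact: cos_le1.
Qed.

(** A product of two cosines is half the sum of two cosines, whose frequencies
are again multiples of [M]; the smaller one, k - j, is positive as j < k. *)
Lemma Rintegral_cosM_le (j k : nat) : (j < k)%N ->
  \int[P]_w (c j w * c k w) <= delta.
Proof.
move=> jk.
have -> : (fun w => c j w * c k w) = (fun w => 2^-1 *
    (cos ((k - j)%:R * M * Y w) + cos ((k + j).+2%:R * M * Y w))).
  apply/funext => w; rewrite /c.
  set a := j.+1%:R * M * Y w; set b := k.+1%:R * M * Y w.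
  have -> : (k - j)%:R * M * Y w = b - a.
    by rewrite /a /b natrB ?(ltnW jk)// -!natr1; ring.
  have -> : (k + j).+2%:R * M * Y w = b + a.
    by rewrite /a /b -!natr1 natrD; ring.
  by rewrite cosB cosD; field.
have kj1 : 1 <= (k - j)%:R :> R by rewrite ler1n subn_gt0.
rewrite RintegralZl//; last first.
  apply: (bounded_integrable P (K := 2)).
    by apply: measurable_funD; exact: mcos.
  by move=> w; apply: (le_trans (ler_normD _ _)); rewrite lerD.
rewrite RintegralD//.
have h1 := cosY (xi := (k - j)%:R * M) (ltac:(by rewrite ler_peMl// ltW)).
have h2 := cosY (xi := (k + j).+2%:R * M) (ltac:(by rewrite ler_peMl ?ler1n// ltW)).
by lra.
Qed.

Lemma Rintegral_sum_cosM_le (n k : nat) : (n <= k)%N ->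
  \int[P]_w (S n w * c k w) <= n%:R * delta.
Proof.
elim: n => [_|n IHn nk].
  under eq_Rintegral do rewrite /S big_ord0 mul0r.
  by rewrite Rintegral_cst// mul0r mul0r.
have -> : (fun w => S n.+1 w * c k w) = (fun w => S n w * c k w + c n w * c k w).
  by apply/funext => w; rewrite /S big_ord_recr/= mulrDl.
rewrite RintegralD//.
- rewrite -natr1 mulrDl mul1r.
  by apply: lerD; [exact/IHn/ltnW|exact: Rintegral_cosM_le].
- apply: (bounded_integrable P (K := n%:R)).
    by apply: measurable_funM => //; exact: mcos.
  by move=> w; rewrite normrM -[leRHS]mulr1 ler_pM ?S_le ?cos_le1.
- apply: (bounded_integrable P (K := 1)).
    by apply: measurable_funM; exact: mcos.
  by move=> w; rewrite normrM -[leRHS]mulr1 ler_pM ?S_le ?cos_le1.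
Qed.

Let iS2 n : P.-integrable setT (EFin \o (fun w => S n w ^+ 2)).
Proof.
apply: (bounded_integrable P (K := n%:R ^+ 2)); first exact: measurable_funX.
by move=> w; rewrite normrX lerXn2r// nnegrE.
Qed.

Lemma Rintegral_sum_cos2_le (n : nat) :
  \int[P]_w (S n w ^+ 2) <= n%:R + n%:R ^+ 2 * delta.
Proof.
elim: n => [|n IHn].
  under eq_Rintegral do rewrite /S big_ord0 expr0n.
  by rewrite Rintegral_cst// !mul0r expr0n mul0r addr0.
have iSc : P.-integrable setT (EFin \o (fun w => S n w * c n w)).
  apply: (bounded_integrable P (K := n%:R)).
    by apply: measurable_funM => //; exact: mcos.
  by move=> w; rewrite normrM -[leRHS]mulr1 ler_pM ?S_le ?cos_le1.
have ic2 : P.-integrable setT (EFin \o (fun w => c n w ^+ 2)).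
  apply: (bounded_integrable P (K := 1)).
    by apply: measurable_funX; exact: mcos.
  by move=> w; rewrite normrX expr_le1 ?cos_le1.
have -> : (fun w => S n.+1 w ^+ 2) =
    (fun w => S n w ^+ 2 + (2 * (S n w * c n w) + c n w ^+ 2)).
  by apply/funext => w; rewrite /S big_ord_recr/=; ring.
have i2 : P.-integrable setT (EFin \o (fun w => 2 * (S n w * c n w))).
  apply: (bounded_integrable P (K := 2 * n%:R)).
    by do 2 apply: measurable_funM => //; exact: mcos.
  by move=> w; rewrite !normrM ger0_norm// ler_wpM2l//
    -[leRHS]mulr1 ler_pM ?S_le ?cos_le1.
have i3 : P.-integrable setT (EFin \o (fun w => 2 * (S n w * c n w) + c n w ^+ 2)).
  exact: (@integrableD _ _ _ P _ _ (EFin \o _) (EFin \o _)).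
rewrite RintegralD// RintegralD// RintegralZl//.
have h1 := Rintegral_sum_cosM_le (leqnn n).
have h2 : \int[P]_w (c n w ^+ 2) <= 1.
  have : \int[P]_w (c n w ^+ 2) <= \int[P]_w (cst 1 w).
    apply: le_Rintegral => //.
      by apply: (bounded_integrable P (K := 1)) => // w; rewrite normr1.
    by move=> w _ /=; rewrite -real_normK ?num_real// expr_le1 ?cos_le1.
  rewrite Rintegral_cst// (_ : fine _ = 1) ?mulr1//.
  by rewrite -[RHS]/(fine 1%E); congr fine; exact: probability_setT.
have h1' := ler_wpM2l (ler0n R 2) h1.
apply: (le_trans (lerD IHn (lerD h1' h2))).
by rewrite -natr1; move: delta0; lra.
Qed.

(** Markov's inequality for the square of [S n], which is at least n^2 / 4 on
the event. *)
Lemma small_ball_prob (n : nat) (e : R) : (0 < n)%N ->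
  (forall x : R, `|x| < e -> 2^-1 <= cos x) ->
  (P [set w | `|n%:R * M * Y w| < e]%R <= (4 / n%:R + 4 * delta)%:E)%E.
Proof.
move=> n0 ecos.
have n0' : 0 < n%:R :> R by rewrite ltr0n.
set A := [set w | _].
have mA : measurable A.
  by apply: measurable_norm_lt; exact: measurable_funM.
have SA w : A w -> n%:R / 2 <= S n w.
  rewrite /A /= => Aw.
  apply: (@le_trans _ _ (\sum_(j < n) 2^-1)).
    by rewrite sumr_const card_ord mulrC mulr_natr.
  apply: ler_sum => j _; apply: ecos; apply: le_lt_trans Aw.
  rewrite -!mulrA !normrM ler_wpM2r// ?mulr_ge0//.
  by rewrite !ger0_norm// ler_nat.
have : (((n%:R / 2) ^+ 2)%:E * P A <= (n%:R + n%:R ^+ 2 * delta)%:E)%E.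
  apply: (@le_trans _ _ (\int[P]_w (S n w ^+ 2)%:E)%E).
    rewrite -integral_cst//.
    apply: (@le_trans _ _ (\int[P]_(w in A) (S n w ^+ 2)%:E)%E).
      apply: ge0_le_integral => //=.
      - apply/measurable_EFinP; apply: measurable_funX; exact: measurable_funTS.
      - move=> w /SA h; rewrite lee_fin lerXn2r ?nnegrE ?divr_ge0//.
        by apply: le_trans h; rewrite divr_ge0.
    apply: ge0_subset_integral => //=.
    - by apply/measurable_EFinP; exact: measurable_funX.
    - by move=> w _; rewrite lee_fin sqr_ge0.
  rewrite -(fineK (integrable_fin_num measurableT (iS2 n))) lee_fin.
  exact: Rintegral_sum_cos2_le.
rewrite -(fineK (fin_num_measure P _ mA)) -EFinM !lee_fin => h.
rewrite -(ler_pM2l (_ : 0 < (n%:R / 2) ^+ 2)); last by rewrite exprn_gt0// divr_gt0.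
apply: (le_trans h); rewrite le_eqVlt; apply/orP; left; apply/eqP; field.
by rewrite gt_eqF.
Qed.

End small_ball.

(** * A stable process at a fixed time *)

Lemma cos_ge_half_near0 (R : realType) :
  exists2 e : R, 0 < e & forall x : R, `|x| < e -> 2^-1 <= cos x.
Proof.
have h2 : 0 < 2^-1 :> R by rewrite invr_gt0.
have /cvgrPdist_lt/(_ _ h2)/nbhs_ballP[e /= e0 he] := @continuous_cos R 0.
exists e => // x xe.
have := he x; rewrite /ball /= sub0r normrN cos0 => /(_ xe).
by rewrite ltr_distlC => /andP[? ?]; lra.
Qed.

Lemma prob_liminf_le (R : realType) d (T : measurableType d)
    (P : probability T R) (E : (set T)^nat) (eta : R) :
  (forall n, measurable (E n)) -> (forall n, (P (E n) <= eta%:E)%E) ->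
  (P (\bigcup_m \bigcap_(n >= m) E n) <= eta%:E)%E.
Proof.
move=> mE PE; pose F m := \bigcap_(n >= m) E n.
have mF m : measurable (F m).
  by apply: bigcap_measurable => [|k _]; [exists m => /=|exact: mE].
have ndF : {homo F : n m / (n <= m)%N >-> (n <= m)%O}.
  move=> n m nm; apply/subsetPset => w h k /= mk; apply: h => /=.
  exact: leq_trans mk.
have cF := nondecreasing_cvg_mu (mu := P) mF (bigcupT_measurable _ mF) ndF.
apply: (cvge_le _ cF); apply: nearW => m /=.
apply: le_trans (PE m); apply: le_measure; rewrite ?inE//.
by move=> w h; apply: (h m) => /=.
Qed.

Section stable_process.
Context (R : realType) d (T : measurableType d) (P : probability T R).
Variables (alpha nu chi : R) (X : R -> {RV P >-> R}).
Hypotheses (alpha1 : 1 < alpha) (chi0 : 0 < chi).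
Hypothesis hX : stable_levy_process P alpha nu chi X.

(** The skewness parameter enters the characteristic exponent only through its
imaginary part, that is through a cosine of modulus at most 1. *)
Lemma stable_cos_le (t xi : R) : 0 <= t ->
  \int[P]_w cos (xi * X t w) <= expR (- (t * `|xi| `^ alpha / chi)).
Proof.
move=> t0; have [_ /(_ t xi t0)] := hX.
move=> /(congr1 (@complex.Re R)); rewrite /charfun /= => ->.
rewrite (mul0r (sin _)) subr0; set c := cos _; set a := (X in expR X * c).
have -> : a = - (t * `|xi| `^ alpha / chi) by rewrite /a; field; rewrite gt_eqF.
by rewrite ler_piMr ?expR_ge0// cos_le1.
Qed.

(** Half of [eta] pays for the number [n] of cosines, half for the decay of
their expectations; uniformity in [s] is what allows a passage to the limit
along a sequence of times. *)
Lemma stable_small_ball (t eta : R) : 0 < t -> 0 < eta ->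
  exists2 e : R, 0 < e &
    forall s, t <= s -> (P [set w | `|X s w| < e]%R <= eta%:E)%E.
Proof.
move=> t0 eta0.
have [e1 e10 cos_ge] := cos_ge_half_near0 R.
(* Then t M / chi >= 8 / eta, and e^(-x) <= 1 / x turns this into eta / 8. *)
pose M := 1 + 8 * chi / (eta * t).
have M1 : 1 < M by rewrite ltrDl divr_gt0 ?mulr_gt0.
have M0 : 0 < M by apply: lt_trans M1.
pose n := (Num.truncn (8 / eta)).+1.
have n8 : 8 / eta < n%:R.
  have /truncn_itv/andP[_] : 0 <= 8 / eta by rewrite divr_ge0// ltW.
  by [].
have n0 : 0 < n%:R :> R by [].
exists (e1 / (n%:R * M)); first by rewrite divr_gt0 ?mulr_gt0.
move=> s ts; have s0 : 0 < s by apply: lt_le_trans ts.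
have cosX xi : M <= xi -> \int[P]_w cos (xi * X s w) <= eta / 8.
  move=> Mxi; have xi1 : 1 <= xi by lra.
  apply: le_trans (stable_cos_le xi (ltW s0)) _.
  set x := s * _ / _.
  have hx : 8 / eta <= x.
    rewrite /x ler_pdivlMr//.
    have h1 : xi <= `|xi| `^ alpha.
      by rewrite ger0_norm ?le1r_powR ?(ltW alpha1)//; lra.
    apply: (@le_trans _ _ (t * M)).
      have -> : t * M = t + 8 / eta * chi by rewrite /M; field; rewrite !gt_eqF.
      by rewrite lerDr ltW.
    by apply: ler_pM; rewrite ?(ltW t0) ?(ltW M0)//; lra.
  rewrite expRN -[leRHS]invrK lef_pV2 ?posrE ?expR_gt0 ?invr_gt0 ?divr_gt0//.
  rewrite invf_div; apply: (le_trans hx); apply: le_trans (expR_ge1Dx x).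
  by rewrite lerDr.
have h := small_ball_prob M0 (ltW (divr_gt0 eta0 (ltr0n R 8))) cosX
  (isT : (0 < n)%N) cos_ge.
apply: le_trans (le_trans h _); last first.
  rewrite lee_fin.
  have : 4 / n%:R <= eta / 2.
    rewrite ler_pdivrMr// -ler_pdivrMl ?divr_gt0//.
    by apply: le_trans (ltW n8); rewrite invf_div; lra.
  by lra.
rewrite le_eqVlt; apply/orP; left; apply/eqP; congr (P _).
have nM0 := mulr_gt0 n0 M0.
have XE w : (`|X s w| < e1 / (n%:R * M)) = (`|n%:R * M * X s w| < e1).
  by rewrite (ltr_pdivlMr _ _ nM0) normrM (ger0_norm (ltW nM0)) mulrC.
by apply/seteqP; split => w /=; rewrite XE.
Qed.

(** A constant sequence gives X_t <> 0; a sequence increasing to t gives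
X_(t-) <> 0. *)
Lemma stable_not_cvg0 (u : R^nat) (t : R) : 0 < t -> (forall n, t <= u n) ->
  {ae P, forall w, ~ X (u n) w @[n --> \oo] --> 0}.
Proof.
move=> t0 tu.
pose E (k n : nat) := [set w | `|X (u n) w| < k.+1%:R^-1].
have mE k n : measurable (E k n) by exact: measurable_norm_lt.
pose N := \bigcap_k \bigcup_m \bigcap_(n >= m) E k n.
have mL k : measurable (\bigcup_m \bigcap_(n >= m) E k n).
  apply: bigcupT_measurable => m.
  by apply: bigcap_measurable => [|n _]; [exists m => /=|exact: mE].
have mN : measurable N by apply: bigcap_measurable => // k _.
exists N; split => //.
- apply/eqP; rewrite eq_le measure_ge0 andbT; apply/lee_addgt0Pr => eta eta0.
  rewrite add0e; have [e e0 he] := stable_small_ball t0 eta0.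
  have [k _ /(_ k (leqnn k)) ke] := near_infty_natSinv_lt (PosNum e0).
  apply: (@le_trans _ _ (P (\bigcup_m \bigcap_(n >= m) E k n))).
    by apply: le_measure; rewrite ?inE// => w; exact.
  apply: prob_liminf_le => // n; apply: le_trans (he _ (tu n)).
  apply: le_measure; rewrite ?inE//; last by move=> w /= h; exact: lt_trans h ke.
  exact: measurable_norm_lt.
- move=> w /= /contrapT cX k _.
  have k0 : 0 < k.+1%:R^-1 :> R by rewrite invr_gt0.
  have /cvgrPdist_lt/(_ _ k0)[m _ hm] := cX.
  exists m => // n /= mn; have := hm n mn.
  by rewrite /E /= sub0r normrN.
Qed.

(** Almost surely the value and the left limit of the path at t are both
nonzero; right-continuity and the left limit then keep the path away from 0 on
each side of t. *)
Lemma stable_bounded_away (t : R) : 0 < t ->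
  {ae P, forall w, exists e a b, [/\ 0 < e, a < t < b &
    forall u, a < u < b -> e <= `|X u w|]}.
Proof.
move=> t0.
pose u n := t - t / 2 * n.+1%:R^-1.
have tu n : t / 2 <= u n.
  have h : n.+1%:R^-1 <= 1 :> R by rewrite invf_le1// ler1n.
  by rewrite /u; move: n.+1%:R^-1 h => v h; nra.
have t20 : 0 < t / 2 by rewrite divr_gt0.
have [hL _] := hX.
have := stable_not_cvg0 (u := fun=> t) t0 (fun=> lexx t).
have := stable_not_cvg0 t20 tu.
have := levy_cadlag hL.
apply: filterS3 => w [rc lc] Xl Xt.
have rct := rc t (ltW t0).
have Xt0 : 0 < `|X t w|.
  by rewrite normr_gt0; apply/eqP => X0; apply: Xt; rewrite X0; exact: cvg_cst.
have /cvg_ex[l cl] := lc t t0.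
have ul : u n @[n --> \oo] --> t.
  rewrite -[Y in _ --> Y]subr0; apply: cvgB; first exact: cvg_cst.
  rewrite -[Y in _ --> Y](mulr0 (t / 2)); apply: cvgM; first exact: cvg_cst.
  exact: cvg_harmonic.
have ut n : u n < t by rewrite /u ltrBlDr ltrDl mulr_gt0// invr_gt0.
have l0 : 0 < `|l|.
  rewrite normr_gt0; apply/eqP => l0; apply: Xl; rewrite -l0.
  by move/cvg_at_leftP : cl; apply.
have far (F : set_system R) (FF : Filter F) (z : R) (f : R -> R) :
    0 < `|z| -> f s @[s --> F] --> z -> \forall s \near F, `|z| / 2 <= `|f s|.
  move=> z0 /cvgrPdist_lt/(_ _ (divr_gt0 z0 (ltr0n R 2))); apply: filterS => s h.
  by have := lerB_dist z (f s); lra.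
have h1 : nbhs t (fun s => t < s -> `|X t w| / 2 <= `|X s w|).
  exact: far _ _ _ _ Xt0 rct.
have h2 : nbhs t (fun s => s < t -> `|l| / 2 <= `|X s w|).
  exact: far _ _ _ _ l0 cl.
have [r1 /= r10 {}h1] := (iffLR (nbhs_ballP _ _) h1).
have [r2 /= r20 {}h2] := (iffLR (nbhs_ballP _ _) h2).
exists (Num.min (`|X t w| / 2) (`|l| / 2)), (t - r2), (t + r1); split.
- by rewrite lt_min !divr_gt0.
- by rewrite gtrBl ltrDl r10 r20.
move=> s /andP[s1 s2]; rewrite ge_min; have [st|ts|->] := ltgtP s t.
- apply/orP; right; apply: (h2 s) => //.
  by rewrite /ball /= ltr_distlC; lra.
- apply/orP; left; apply: (h1 s) => //.
  by rewrite /ball /= ltr_distlC; lra.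
- by apply/orP; left; lra.
Qed.

End stable_process.

(** * The local time fractional Brownian motion *)

Section local_time_fbm.
Context (R : realType) d (T : measurableType d) (P : probability T R).
Variables (W X : R -> {RV P >-> R}) (L : R -> R -> {RV P >-> R}).
Hypothesis cW : forall w, continuous (fun t => W t w).
Hypothesis hL : local_time P X L.

Local Notation Z := (local_time_fbm W L).

Let cL2 w :
  {within [set p : R * R | 0 <= p.2], continuous (fun p => L p.1 p.2 w)}.
Proof. exact: (local_time_continuous hL). Qed.

(** The local time is only controlled at nonnegative times, whence the
truncation of [s]; it yields paths continuous on the whole line. *)
Lemma continuous_local_time_fbm w : continuous (fun s : R => Z (Num.max 0 s) w).
Proof.
have cL : continuous (fun s : R => L 0 (Num.max 0 s) w).
  have cg : continuous (fun s : R => (0 : R, Num.max 0 s)).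
    move=> u; apply: (@cvg_pair _ _ _ (nbhs u) (nbhs (0 : R)) (nbhs (Num.max 0 u))).
      exact: cvg_cst.
    by apply: continuous_max; [exact: cst_continuous|exact: cvg_id].
  have g0 (s : R) : [set p : R * R | 0 <= p.2] (0 : R, Num.max 0 s).
    by rewrite /= le_max lexx.
  exact: continuous_comp_within (@cL2 w) cg g0.
move=> s; exact: continuous_comp (cL s) (@cW w _).
Qed.

Lemma measurable_local_time_fbm s : measurable_fun setT (Z s).
Proof.
by apply: (@measurable_random_time _ _ _ W (L 0 s)) => // t;
  exact: measurable_funP.
Qed.

Lemma ae_local_time_fbm_start : (forall w, W 0 w = 0) ->
  {ae P, forall w, Z 0 w = 0}.
Proof.
move=> W0; apply: filterS (local_time_density hL) => w lw.
rewrite /local_time_fbm (local_time_start (x := fun s => X s w)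
  (l := fun y s => L y s w) lw (@cL2 w)).
exact: W0.
Qed.

Definition start_oscillation (t : R) (w : T) : R :=
  max_on [set s | 0 <= s <= t] (fun s => `|Z s w - Z 0 w|).

Lemma start_oscillationE t w : start_oscillation t w =
  max_on [set s | 0 <= s <= t] (fun s => `|Z (Num.max 0 s) w - Z 0 w|).
Proof. by apply: eq_max_on => s /andP[s0 _]; rewrite max_r. Qed.

Let cY w : continuous (fun s : R => `|Z (Num.max 0 s) w - Z 0 w|).
Proof.
move=> s; apply: cvg_norm; apply: cvgB; last exact: cvg_cst.
exact: continuous_local_time_fbm.
Qed.

Lemma measurable_start_oscillation (t x : R) : 0 <= t ->
  measurable [set w | x < start_oscillation t w].
Proof.
move=> t0; under eq_set do rewrite start_oscillationE.
apply: (@measurable_lt_max_on _ _ _ (fun s w => `|Z (Num.max 0 s) w - Z 0 w|)) => //.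
move=> s; apply: measurableT_comp => //; apply: measurable_funB;
  exact: measurable_local_time_fbm.
Qed.

Lemma start_oscillation_le w (s t : R) : 0 <= s -> s <= t ->
  start_oscillation s w <= start_oscillation t w.
Proof.
move=> s0 st; rewrite !start_oscillationE; apply: max_on_subset.
- by exists 0; rewrite /= lexx.
- by move=> u /= /andP[-> /le_trans]; exact.
- rewrite (_ : mkset _ = `[0, t]%classic); first exact: segment_compact.
  by apply/seteqP; split=> u; rewrite /= in_itv.
- exact: continuous_subspaceT.
Qed.

(** On such a path the local time at 0, and with it the process, is constant
near t: the numerator is 0 for small h, whatever the normalisation [g]. *)
Lemma local_time_fbm_limsup0 (t : R) (w : T) (g : R -> R) (K : R) :
  0 < t -> 0 <= K ->
  occupation_density (fun s => X s w) (fun y s => L y s w) ->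
  (exists e a b, [/\ 0 < e, a < t < b &
    forall u, a < u < b -> e <= `|X u w|]) ->
  (limf_esup (fun h : R =>
     (max_on [set s | `|s| <= h]%R (fun s => `|Z (t + s) w - Z t w|) / g h)%R%:E)
     (0^'+) <= K%:E)%E.
Proof.
move=> t0 K0 lw [e [a [b [e0 /andP[a_t t_b] Xe]]]].
apply: limf_esup_le_near; near=> h => /=.
have h0 : 0 < h by near: h; exact: nbhs_right_gt.
rewrite (@max_on_cst _ _ _ 0) ?mul0r ?lee_fin//.
  by exists 0; rewrite /= normr0 ltW.
move=> s /= sh.
have ha : h < t - a by near: h; apply: nbhs_right_lt; rewrite subr_gt0.
have hb : h < b - t by near: h; apply: nbhs_right_lt; rewrite subr_gt0.
have ht : h < t by near: h; exact: nbhs_right_lt.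
move: sh; rewrite ler_norml => /andP[hs sh].
rewrite /local_time_fbm (@local_time_locally_constant _ (fun s => X s w)
  (fun y s => L y s w) lw (@cL2 w) 0 e a b (t + s) t e0) ?subrr ?normr0//; try lra.
by move=> u uab; rewrite subr0; exact: Xe.
Unshelve. all: by end_near. Qed.

End local_time_fbm.

Theorem theorem5p2 (R : realType) (d : measure_display) (T : measurableType d)
  (P : probability T R) (H alpha nu chi : R)
  (W : R -> {RV P >-> R}) (X : R -> {RV P >-> R}) (L : R -> R -> {RV P >-> R})
  (A7 A8 : R)
  (hH : 0 < H < 1) (halpha : 1 < alpha <= 2)
  (hnu : -1 <= nu <= 1) (hchi : 0 < chi)
  (hW : fractional_brownian_motion P H W)
  (hX : stable_levy_process P alpha nu chi X)
  (hWX : independent_processes P setT W [set t | 0 <= t] X)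
  (hL : local_time P X L)
  (hA7 : 0 < A7) (hA8 : 0 < A8)
  (htail : forall a b x : R, 0 <= a -> a < b -> 0 < x ->
    (P [set w | x < max_on [set t | a <= t <= b]
                      (fun t => `|local_time_fbm W L t w
                                  - local_time_fbm W L a w|)]%R
     <= (A7 * expR (- (A8 * (x `^ (2 * alpha / (alpha + 2 * H)) /
          (b - a) `^ (2 * H * (alpha - 1) / (alpha + 2 * H))))))%:E)%E) :
  {ae P, forall w,
    (limf_esup (fun t : R =>
       (max_on [set s | 0 <= s <= t] (fun s => `|local_time_fbm W L s w|) /
        (t `^ (H * (alpha - 1) / alpha) *
         ln (ln t) `^ ((alpha + 2 * H) / (2 * alpha))))%R%:E)
      (pinfty_nbhs R)
     <= (A8 `^ (- ((alpha + 2 * H) / (2 * alpha))))%:E)%E}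
  /\
  (forall t : R, 0 < t ->
    {ae P, forall w,
      (limf_esup (fun h : R =>
         (max_on [set s | `|s| <= h]
            (fun s => `|local_time_fbm W L (t + s) w
                        - local_time_fbm W L t w|) /
          (h `^ (H * (alpha - 1) / alpha) *
           ln (ln (1 / h)) `^ ((alpha + 2 * H) / (2 * alpha))))%R%:E)
        (0^'+)
       <= (A8 `^ (- ((alpha + 2 * H) / (2 * alpha))))%:E)%E}).
Proof.
have [H0 H1] := andP hH; have [alpha1 alpha2] := andP halpha.
have alpha0 : 0 < alpha by lra.
have aH0 : 0 < alpha + 2 * H by lra.
have cW := fbm_continuous hW.
split; last first.
  move=> t t0.
  have := stable_bounded_away alpha1 hchi hX t0.
  have := local_time_density hL.
  apply: filterS2 => w lw Xw.
  by apply: (local_time_fbm_limsup0 W hL) => //; exact: powR_ge0.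
set p := 2 * alpha / (alpha + 2 * H) in htail.
set q := 2 * H * (alpha - 1) / (alpha + 2 * H) in htail.
have p0 : 0 < p by rewrite divr_gt0 ?mulr_gt0.
have q0 : 0 <= q by rewrite divr_ge0 ?mulr_ge0 ?subr_ge0 ?ltW.
have -> : (alpha + 2 * H) / (2 * alpha) = p^-1 by rewrite invf_div.
have -> : H * (alpha - 1) / alpha = q / p.
  by rewrite /p /q; field; rewrite !gt_eqF.
have := ae_local_time_fbm_start hL (fbm_0 hW).
have : {ae P, forall w, (limf_esup (fun t =>
    (start_oscillation W L t w / lil_gauge (q / p) p^-1 t)%:E) (pinfty_nbhs R)
    <= (A8 `^ (- p^-1))%:E)%E}.
  apply: (lil_upper_bound (C := A7) (ltW hA7) hA8 p0 q0).
  - by move=> t x t0 _; apply: (measurable_start_oscillation cW hL); exact: ltW.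
  - by move=> w s t s0; apply: (start_oscillation_le cW hL); exact: ltW.
  - by move=> t x t0 x0; have := htail 0 t x (lexx 0) t0 x0; rewrite subr0.
apply: filterS2 => w lil Z0; apply: le_trans lil.
rewrite le_eqVlt; apply/orP; left; apply/eqP; congr (limf_esup _ _).
apply/funext => t; congr (_%:E); congr (_ / _).
by apply: eq_max_on => s _; rewrite Z0 subr0.
Qed.
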